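(* Let $\mathbb{F}$ be an arbitrary field and let $\Phi: M_n(\mathbb{F}) \to M_r(\mathbb{F})$ be a linear map preserving zero products. Then there exist a nonnegative integer $k$ with $nk \le r$, invertible $S \in M_r(\mathbb{F})$ and $R_1 \in M_k(\mathbb{F})$, and a zero product preserving linear map $\Phi_0: M_n(\mathbb{F}) \to M_{r-nk}(\mathbb{F})$ whose values are nilpotent, such that $$\Phi(A) = S\begin{pmatrix} R_1\otimes A & 0\\ 0 & \Phi_0(A)\end{pmatrix}S^{-1}\quad\text{for all } A. \qquad (\ast)$$ Furthermore: (a) If $\Phi$ sends rank one idempotents to idempotents, then $\Phi_0 = 0$, i.e. $\Phi(A) = S\begin{pmatrix} R_1\otimes A & 0\\ 0 & 0_{r-nk}\end{pmatrix}S^{-1}$. $(\ast\ast)$ (b) If $\mathbb{F} = \mathbb{C}$ and $\Phi(A)^* = \Phi(A)$ for every rank one orthogonal projection $A$, then $\Phi$ has the form $(\ast\ast)$ with $R_1 = R_1^*$ and $S$ unitary ($S^{-1}=S^*$). (c) If $\mathbb{F} = \mathbb{R}$ and $\Phi(A) = \Phi(A)^{\mathrm t}$ for every symmetric rank one idempotent $A$, then $\Phi$ has the form $(\ast)$ with $S$ real orthogonal, $\Phi_0(A) = 0$ for every symmetric $A$, and $\Phi_0(X)\Phi_0(Y) = 0$ for all $X,Y \in M_n(\mathbb{R})$. (d) If $\mathbb{F} = \mathbb{C}$, $\Phi(I_n)$ is diagonalizable and $\Phi(A)^{\mathrm t} = \Phi(A)$ for every rank one real symmetric idempotent $A$, then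 $\Phi$ has the form $(\ast)$ with $R_1 = R_1^{\mathrm t}$ and $S$ complex orthogonal ($S^{-1}=S^{\mathrm t}$).
   Context: A map $\Phi$ preserves zero products if $\Phi(A)\Phi(B)=0$ whenever $AB=0$. For $R=[r_{ij}]\in M_k$ and $A\in M_n$, $R\otimes A$ denotes the Kronecker product $[r_{ij}A]\in M_{kn}$. $A^{\mathrm t}$ is the transpose, $A^*$ the conjugate transpose. An orthogonal projection is a matrix with $A=A^2=A^*$. Either block in the displayed forms may be vacuous ($k=0$ or $nk=r$). *)

(* Defs.v *)
From HB Require Import structures.
From mathcomp Require Import all_boot all_order all_algebra.
Set Implicit Arguments. Unset Strict Implicit. Unset Printing Implicit Defensive.
Import Order.TTheory GRing.Theory Num.Theory.
Local Open Scope ring_scope.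

Definition mxentry (F : fieldType) p q (M : 'M[F]_(p, q)) (a b : nat) : F :=
  match insub a, insub b with
  | Some i, Some j => M i j
  | _, _ => 0
  end.

(* Kronecker product R (x) A = [r_ij A] : the (a,b) entry, with
   a = i*n + p, b = j*n + q (p,q < n), is r_ij * a_pq. *)
Definition kron (F : fieldType) k n (R : 'M[F]_k) (A : 'M[F]_n) : 'M[F]_(k * n) :=
  \matrix_(a < k * n, b < k * n)
     (mxentry R (a %/ n) (b %/ n) * mxentry A (a %% n) (b %% n)).

Definition zero_prod_pres (F : fieldType) n r (Phi : 'M[F]_n -> 'M[F]_r) :=
  forall A B : 'M[F]_n, A *m B = 0 -> Phi A *m Phi B = 0.

Definition mx_nilpotent (F : fieldType) m (M : 'M[F]_m) := exists p : nat, M ^+ p = 0.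

Definition idempotent_mx (F : fieldType) n (A : 'M[F]_n) := A *m A = A.

Definition rank1_idem (F : fieldType) n (A : 'M[F]_n) := \rank A = 1%N /\ idempotent_mx A.

Definition adjmx (C : numClosedFieldType) p q (A : 'M[C]_(p, q)) : 'M[C]_(q, p) :=
  map_mx Num.conj_op A^T.

Definition block_form (F : fieldType) n r (Phi : 'M[F]_n -> 'M[F]_r) k m
  (e : (k * n + m)%N = r) (S : 'M[F]_r) (R1 : 'M[F]_k) (Phi0 : 'M[F]_n -> 'M[F]_m) :=
  forall A : 'M[F]_n,
    Phi A = S *m castmx (e, e) (block_mx (kron R1 A) 0 0 (Phi0 A)) *m invmx S.

(* Main.v *)
Require Import Defs.
From HB Require Import structures.
From mathcomp Require Import all_boot all_order all_algebra.
From mathcomp Require Import mxtens.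
Import Order.TTheory GRing.Theory Num.Theory.
Local Open Scope ring_scope.
Set Implicit Arguments. Unset Strict Implicit. Unset Printing Implicit Defensive.

(* Put T = Phi(1). Since M_n is spanned by idempotents, preserving zero products
   gives Phi(AB) Phi(C) = Phi(A) Phi(BC); hence Phi(A) Phi(B) = T Phi(AB) and T
   commutes with the range of Phi. Let G be the Drazin inverse of T. Then P = T G
   is the Fitting projection of T, the maps G Phi(E_ij) are matrix units with sum P,
   and splitting G Phi(E_11) = U V with V U = 1 yields R_1 = V T U on the range of P;
   on the range of 1 - P, T is nilpotent and Phi(A)^(j+1) = T^j Phi(A^(j+1)).

   In (b), (c) and (d), let * be the (conjugate) transpose. The hypothesis forces
   T* = T, so G* = G by uniqueness, and G Phi(E_ij) = G Phi(E_ii) G Phi(E_ij + E_ji)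
   shows that A -> G Phi(A) commutes with *. A selfadjoint idempotent factors as
   V* V with V V* = 1, so all the splittings above can be taken orthogonal. Over R,
   or over C with the conjugate transpose, a nilpotent selfadjoint matrix vanishes,
   which kills Phi_0 on selfadjoint matrices. *)

(** * Drazin inverses *)

Definition drazin_inverse (F : fieldType) r (T : 'M[F]_r) (N : nat) (G : 'M_r) :=
  [/\ GRing.comm T G, G * T * G = G & T ^+ N * (T * G) = T ^+ N].

(** Write the characteristic polynomial as X^N q with q(0) nonzero and q = q(0) (1 - X g). By
    Cayley-Hamilton, T^N = T^N (T g(T)). The inverse is then found among the polynomials in T, so it
    commutes with whatever commutes with T. *)
Lemma drazin_inverse_exists (F : fieldType) r (T : 'M[F]_r) :
  exists N G, drazin_inverse T N G /\ forall B, GRing.comm B T -> GRing.comm B G.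
Proof.
case: r T => [|r] T.
  by exists 0, 0; split=> [|B _]; first split; apply/matrixP => -[].
have [N [q]] := multiplicity_XsubC (char_poly T) 0.
rewrite -size_poly_eq0 size_char_poly /= polyC0 subr0 rootE => q0 chT.
have /factor_theorem[h hE] : root (q - q.[0]%:P) 0.
  by rewrite rootE hornerD hornerN hornerC subrr.
pose f := horner_mx T; pose g := - q.[0]^-1 *: h.
have fM p1 p2 : f (p1 * p2) = f p1 * f p2 by apply: rmorphM.
have fX : f 'X = T by apply: horner_mx_X.
have qN : q = q.[0]%:P * (1 - 'X * g).
  rewrite -[LHS](subrK q.[0]%:P) hE polyC0 subr0 mulrBr mulr1 addrC; congr (_ + _).
  rewrite mulrCA /g scaleNr mulrN mulrN opprK mul_polyC scalerA divff // scale1r.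
  exact: mulrC.
have T1 : f ('X^N * ('X * g)) = f 'X^N.
  apply/esym/eqP; rewrite -subr_eq0 -rmorphB -{1}['X^N]mulr1 -mulrBr.
  have /eqP : f (char_poly T) = 0 by apply: Cayley_Hamilton.
  rewrite chT {1}qN -mulrA mul_polyC [_ * 'X^N]mulrC /f linearZ /= scaler_eq0.
  by rewrite (negPf q0).
have TE j : f ('X^N * ('X * g) ^+ j) = f 'X^N.
  elim: j => [|j IH]; first by rewrite expr0 mulr1.
  by rewrite exprS mulrA fM T1 -fM.
have e1 : 'X^N * g ^+ N.+1 * 'X * ('X^N * g ^+ N.+1)
  = 'X^N * ('X * g) ^+ N.+1 * g ^+ N.+1.
  have perm (a b c : {poly F}) : a * b * c * (a * b) = a * (a * c * b) * b.
    rewrite !mulrA; congr (_ * _); rewrite -!mulrA; congr (_ * _).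
    by rewrite mulrA mulrC [b * c]mulrC.
  by rewrite perm exprMn [in RHS]exprSr.
(* The exponents make X times this witness equal to (X g)^(N+1), which X^N absorbs by [TE]. *)
exists N, (f ('X^N * g ^+ N.+1)); split; last by move=> B BT; apply: comm_mx_horner.
split.
- exact/comm_mx_horner.
- by rewrite -{1}fX -!fM e1 fM TE -fM.
have TN : T ^+ N = f 'X^N by rewrite [RHS]rmorphXn /= -/f fX.
rewrite TN -[X in _ * (X * _)]fX -!fM -[RHS](TE N.+1).
by apply: (congr1 f); rewrite exprMn ['X^(N.+1)]exprS !mulrA.
Qed.

(** Since K = K^(N+1) T^N, a Drazin inverse K absorbs T L for any other one, L. Hence G = G T H and
    H = H T G, and the two right sides agree by commutation. *)
Lemma drazin_inverse_unique (F : fieldType) r (T : 'M[F]_r) N G H :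
  drazin_inverse T N G -> drazin_inverse T N H -> GRing.comm G H -> G = H.
Proof.
have absorb K L : drazin_inverse T N K -> T ^+ N * (T * L) = T ^+ N -> K = K * (T * L).
  move=> [cK KTK _] TL.
  have KX j : K = K ^+ j.+1 * T ^+ j.
    elim: j => [|j IH]; first by rewrite expr1 expr0 mulr1.
    by rewrite exprS [T ^+ j.+1]exprSr -mulrA [K ^+ j.+1 * _]mulrA -IH -cK mulrA KTK.
  by rewrite (KX N) -mulrA TL.
move=> dG dH GH; have [cG _ TG] := dG; have [cH _ TH] := dH.
by rewrite [LHS](absorb G H) // [RHS](absorb H G) // cG cH !mulrA GH.
Qed.

(** * Product identities for zero product preserving maps *)

Section ZeroProducts.
Variables (F : fieldType) (n r : nat) (Phi : {linear 'M[F]_n -> 'M[F]_r}).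
Hypothesis Phi_zp : zero_prod_pres Phi.
Let T := Phi 1.

(* [Phi (A B) Phi C - Phi A Phi (B C)] vanishes for idempotent [B], and the
   idempotents [E_ii] and [E_ii + E_ij] span the whole matrix algebra. *)
Lemma zero_prod_transfer A B C : Phi (A * B) * Phi C = Phi A * Phi (B * C).
Proof.
pose good B := Phi (A * B) * Phi C = Phi A * Phi (B * C).
have goodD B1 B2 : good B1 -> good B2 -> good (B1 + B2).
  by rewrite /good => E1 E2; rewrite mulrDr mulrDl !linearD /= mulrDl mulrDr E1 E2.
have goodZ a B1 : good B1 -> good (a *: B1).
  rewrite /good => E1.
  have -> : A * (a *: B1) = a *: (A * B1) by apply/esym/scalemxAr.
  have -> : a *: B1 * C = a *: (B1 * C) by apply/esym/scalemxAl.
  by rewrite !linearZ /= -[LHS]scalemxAl -[RHS]scalemxAr mulmxE E1.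
have good_idem P : P * P = P -> good P.
  (* A P kills (1 - P) C and A (1 - P) kills P C, so both sides reduce to Phi(A P) Phi(P C). *)
  move=> PP; have e1 : Phi (A * P) * Phi ((1 - P) * C) = 0.
    by apply: Phi_zp; rewrite mulmxE mulrA -[A * P * _]mulrA mulrBr PP mulr1 subrr mulr0 mul0r.
  have e2 : Phi (A * (1 - P)) * Phi (P * C) = 0.
    by apply: Phi_zp; rewrite mulmxE mulrA -[A * _ * _]mulrA mulrBl PP mul1r subrr mulr0 mul0r.
  apply: (@eq_trans _ _ (Phi (A * P) * Phi (P * C))).
    by apply/eqP; rewrite -subr_eq0 -mulrBr -linearB /= -[X in X - _]mul1r -mulrBl e1.
  by apply/eqP; rewrite eq_sym -subr_eq0 -mulrBl -linearB /= -[X in X - _]mulr1 -mulrBr e2.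
have dd (i j k l : 'I_n) : delta_mx i j * delta_mx k l = delta_mx i l *+ (j == k) :> 'M[F]_n.
  exact: mul_delta_mx_cond.
have gii i : good (delta_mx i i) by apply: good_idem; rewrite dd eqxx.
have good_delta i j : good (delta_mx i j).
  have [->//|ij] := eqVneq i j.
  rewrite -[delta_mx i j](addrK (delta_mx i i)) -scaleN1r.
  apply: goodD (goodZ _ _ (gii i)); apply: good_idem.
  by rewrite mulrDl !mulrDr !dd eqxx [j == i]eq_sym (negPf ij) !mulr0n !add0r addrC.
have good0 : good 0 by rewrite /good mulr0 mul0r !linear0 mul0r mulr0.
rewrite -/(good B) [B]matrix_sum_delta; apply: big_ind => // i _.
by apply: big_ind => // j _; apply: goodZ.
Qed.

Lemma zero_prod_mul A B : Phi A * Phi B = T * Phi (A * B).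
Proof. by rewrite /T -zero_prod_transfer mul1r. Qed.

Lemma zero_prod_comm A : GRing.comm (Phi A) T.
Proof.
have := zero_prod_mul A 1; rewrite mulr1 -/T => AT.
exact: AT.
Qed.

Lemma zero_prod_exp A j : Phi A ^+ j.+1 = T ^+ j * Phi (A ^+ j.+1).
Proof.
elim: j => [|j IH]; first by rewrite !expr1 expr0 mul1r.
by rewrite exprS IH mulrA (commrX _ (zero_prod_comm A)) -mulrA (zero_prod_mul A) mulrA
  -exprSr -exprS.
Qed.

End ZeroProducts.

(** * Kronecker products and systems of matrix units *)

Lemma kronE (F : fieldType) k n (R : 'M[F]_k) (A : 'M[F]_n) : kron R A = R *t A.
Proof.
apply/matrixP => a b; rewrite !mxE /mxentry.
rewrite !(insubT (fun x => (x < k)%N) (mxtens_index_proof1 _)).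
by rewrite !(insubT (fun x => (x < n)%N) (mxtens_index_proof2 _)).
Qed.

Section MatrixUnits.
Variables (F : fieldType) (n r k : nat) (E : 'I_n -> 'I_n -> 'M[F]_r) (i0 : 'I_n).

(** The columns of [U] are meant to span the range of [E i0 i0]; [E p i0] carries them into the
    range of [E p p]. The pairs (i, p) are ordered as in the Kronecker product. *)
Definition units_col (U : 'M[F]_(r, k)) : 'M_(r, k * n) :=
  \matrix_(x, a) (E (mxtens_unindex a).2 i0 *m U) x (mxtens_unindex a).1.

Definition units_row (V : 'M[F]_(k, r)) : 'M_(k * n, r) :=
  \matrix_(a, x) (V *m E i0 (mxtens_unindex a).2) (mxtens_unindex a).1 x.

(** The middle factor is left free: M = 1 gives biorthogonality of rows and columns, M = Phi A gives
    the Kronecker corner of Phi. *)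
Lemma units_row_col U V M j q i p :
  (units_row V *m M *m units_col U) (mxtens_index (j, q)) (mxtens_index (i, p)) =
  (V *m (E i0 q *m M *m E p i0) *m U) j i.
Proof.
have entry m1 m2 (B : 'M[F]_(m1, r)) (C : 'M[F]_(r, m2)) a b :
    (B *m M *m C) a b = (row a B *m M *m col b C) 0 0.
  by rewrite rowE colE mulmxA -[delta_mx 0 a *m B *m M]mulmxA -[X in X *m delta_mx b 0]mulmxA
    -rowE -colE !mxE.
have -> : V *m (E i0 q *m M *m E p i0) *m U = V *m E i0 q *m M *m (E p i0 *m U).
  by rewrite !mulmxA.
rewrite entry [RHS]entry.
have -> : row (mxtens_index (j, q)) (units_row V) = row j (V *m E i0 q).
  by apply/rowP => x; rewrite !mxE mxtens_indexK.
have -> // : col (mxtens_index (i, p)) (units_col U) = col i (E p i0 *m U).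
by apply/colP => x; rewrite !mxE mxtens_indexK.
Qed.

Hypothesis Emul : forall i j k l, E i j *m E k l = E i l *+ (j == k).
Variables (U : 'M[F]_(r, k)) (V : 'M[F]_(k, r)).
Hypotheses (UV : U *m V = E i0 i0) (VU : V *m U = 1%:M).

Lemma units_row_col1 : units_row V *m units_col U = 1%:M.
Proof.
apply/matrixP => a b; rewrite -(mxtens_unindexK a) -(mxtens_unindexK b).
case: (mxtens_unindex a) => j q; case: (mxtens_unindex b) => i p.
rewrite -[units_row V]mulmx1 units_row_col mulmx1 Emul [RHS]mxE.
have -> : (mxtens_index (j, q) == mxtens_index (i, p)) = (j == i) && (q == p).
  by rewrite -xpair_eqE; apply: can_eq (@mxtens_indexK k n) _ _.
case: (q == p); last by rewrite andbF mulr0n mulmx0 mul0mx mxE.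
by rewrite andbT mulr1n -UV mulmxA VU mul1mx VU mxE.
Qed.

(** Summing over i first turns U V back into [E i0 i0], and E p i0 E i0 i0 E i0 p = E p p. *)
Lemma units_col_row : units_col U *m units_row V = \sum_p E p p.
Proof.
apply/matrixP => x y; rewrite mxE summxE.
rewrite (reindex (@mxtens_index k n)); last first.
  by exists (@mxtens_unindex k n) => ? _; rewrite (mxtens_indexK, mxtens_unindexK).
transitivity (\sum_(ip : 'I_k * 'I_n) (E ip.2 i0 *m U) x ip.1 * (V *m E i0 ip.2) ip.1 y).
  by apply: eq_bigr => ip _; rewrite !mxE mxtens_indexK.
rewrite -(pair_bigA _ (fun i p => (E p i0 *m U) x i * (V *m E i0 p) i y)) exchange_big /=.
apply: eq_bigr => p _.
have <- : E p i0 *m E i0 i0 *m E i0 p = E p p.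
  by rewrite Emul eqxx mulr1n Emul eqxx mulr1n.
by rewrite -UV !mulmxA -[_ *m V *m _]mulmxA mxE.
Qed.

End MatrixUnits.

(** * Block form from two complementary splittings *)

Lemma block_formP (F : fieldType) n r (Phi : 'M[F]_n -> 'M[F]_r) k m
    (X : 'M_(r, k * n)) (Y : 'M_(k * n, r)) (X' : 'M_(r, m)) (Y' : 'M_(m, r)) R1 :
  Y *m X = 1%:M -> Y' *m X' = 1%:M -> X *m Y + X' *m Y' = 1%:M ->
  (forall A, comm_mx (Phi A) (X *m Y)) -> (forall A, Y *m Phi A *m X = kron R1 A) ->
  exists e : (k * n + m)%N = r,
    let S := castmx (erefl r, e) (row_mx X X') in
    [/\ S \in unitmx, invmx S = castmx (e, erefl r) (col_mx Y Y')
      & block_form Phi e S R1 (fun A => Y' *m Phi A *m X')].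
Proof.
move=> YX YX' XY cP PhiR.
have E0 m1 m2 (B C : 'M[F]_(m1, m2)) : B = B + C -> C = 0.
  by move/eqP; rewrite -subr_eq0 opprD addrA subrr sub0r oppr_eq0 => /eqP.
(* Inserting 1 = X Y + X' Y' into B = Y X' gives B = B + B, so B = 0 in every characteristic; Y' X
   vanishes likewise. *)
have o1 : Y *m X' = 0.
  apply: (E0 _ _ (Y *m X')); rewrite -{1}[X']mul1mx -XY mulmxDl mulmxDr.
  by rewrite -!mulmxA YX' mulmx1 2!mulmxA YX mul1mx.
have o2 : Y' *m X = 0.
  apply: (E0 _ _ (Y' *m X)); rewrite -{1}[X]mul1mx -XY mulmxDl mulmxDr.
  by rewrite -!mulmxA YX mulmx1 [X in _ + X]mulmxA YX' mul1mx.
have WZ : row_mx X X' *m col_mx Y Y' = 1%:M by rewrite mul_row_col.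
have ZW : col_mx Y Y' *m row_mx X X' = 1%:M.
  by rewrite mul_col_row YX YX' o1 o2 -scalar_mx_block.
(* Each of the two identity products bounds one size by the other. *)
have e : (k * n + m)%N = r.
  by apply/eqP; rewrite eqn_leq (mulmx1_min WZ) (mulmx1_min ZW).
exists e; case: r / e => /= in Phi X Y X' Y' YX YX' XY cP PhiR o1 o2 WZ ZW *.
rewrite !castmx_id; have [uW _] := mulmx1_unit WZ.
have iW : invmx (row_mx X X') = col_mx Y Y' by rewrite -[LHS]mulmx1 -WZ mulKmx.
split=> // A; rewrite castmx_id iW.
have cXY : X *m Y *m Phi A = Phi A *m X *m Y by rewrite -cP mulmxA.
(* The off-diagonal blocks vanish because X Y commutes with Phi A. *)
have b1 : Y *m Phi A *m X' = 0.
  rewrite -{1}[Y]mul1mx -YX.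
  have -> : Y *m X *m Y *m Phi A *m X' = Y *m (X *m Y *m Phi A) *m X' by rewrite !mulmxA.
  by rewrite cXY -!mulmxA o1 !mulmx0.
have b2 : Y' *m Phi A *m X = 0.
  rewrite -{1}[X]mulmx1 -YX.
  have -> : Y' *m Phi A *m (X *m (Y *m X)) = Y' *m (Phi A *m X *m Y) *m X by rewrite !mulmxA.
  by rewrite -cXY !mulmxA o2 !mul0mx.
rewrite -PhiR -b1 -b2 -mul_col_row -mul_col_mx.
by rewrite !mulmxA WZ mul1mx -mulmxA WZ mulmx1.
Qed.

Lemma delta_mul_delta (F : fieldType) n (A : 'M[F]_n) (i q p j : 'I_n) :
  delta_mx i q *m A *m delta_mx p j = A q p *: delta_mx i j.
Proof.
rewrite -(mul_delta_mx (0 : 'I_1) i q) -(mul_delta_mx (0 : 'I_1) p j).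
rewrite -(mulmxA (delta_mx i 0)) -rowE -mulmxA [row q A *m _]mulmxA -colE.
by rewrite [col _ _]mx11_scalar mul_scalar_mx -scalemxAr mul_delta_mx !mxE.
Qed.

(** * Splitting along the Fitting projection *)

Section BlockDecomposition.
Variables (F : fieldType) (n r : nat) (Phi : {linear 'M[F]_n -> 'M[F]_r}).
Hypothesis Phi_zp : zero_prod_pres Phi.
Let T := Phi 1%:M.
Variables (N : nat) (G : 'M[F]_r).
Hypotheses (dG : drazin_inverse T N G) (cG : forall B, GRing.comm B T -> GRing.comm B G).

Let PhiT A : GRing.comm (Phi A) T. Proof. exact: zero_prod_comm. Qed.
Let PhiG A : GRing.comm (Phi A) G. Proof. exact/cG. Qed.
Let PhiM A B : Phi A * Phi B = T * Phi (A * B). Proof. exact: zero_prod_mul. Qed.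

(** Since X' Y' = 1 - T G commutes with the range of Phi, compression to it respects products, and
    hence zero products. It is nilpotent because Phi(A)^(N+1) has the factor T^N, which 1 - T G
    kills. The second triple exposes S and Phi0 so that selfadjointness can be read off later. *)
Lemma block_decomposition k m (X : 'M_(r, k * n)) Y (X' : 'M_(r, m)) Y' R1 :
  Y *m X = 1%:M -> X *m Y = T *m G -> Y' *m X' = 1%:M -> X' *m Y' = 1%:M - T *m G ->
  (forall A, Y *m Phi A *m X = kron R1 A) ->
  exists (e : (k * n + m)%N = r) (S : 'M_r) (Phi0 : {linear 'M[F]_n -> 'M[F]_m}),
    [/\ S \in unitmx, zero_prod_pres Phi0, (forall A, mx_nilpotent (Phi0 A))
      & block_form Phi e S R1 Phi0] /\
    [/\ S = castmx (erefl r, e) (row_mx X X'),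
        invmx S = castmx (e, erefl r) (col_mx Y Y')
      & forall A, Phi0 A = Y' *m Phi A *m X'].
Proof.
move=> YX XY YX' XY' PhiR.
have [||e [uS iS fS]] := @block_formP F n r Phi k m X Y X' Y' R1 YX YX' _ _ PhiR.
- by rewrite XY XY' addrC subrK.
- by move=> A; rewrite XY; apply: comm_mxM; [apply: PhiT|apply: PhiG].
have cXY' A : comm_mx (Phi A) (X' *m Y').
  by rewrite XY'; apply/comm_mxB/comm_mxM; [apply: comm_mx1|apply: PhiT|apply: PhiG].
have Y'E : Y' *m (X' *m Y') = Y' by rewrite mulmxA YX' mul1mx.
pose Phi0 : {linear 'M[F]_n -> 'M[F]_m} := mulmx Y' \o (mulmxr X' \o Phi).
have Phi0E A : Phi0 A = Y' *m Phi A *m X' by rewrite /= mulmxA.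
exists e, (castmx (erefl r, e) (row_mx X X')), Phi0.
have Phi0M A B : Y' *m A *m X' *m (Y' *m Phi B *m X') = Y' *m (A *m Phi B) *m X'.
  have -> : Y' *m A *m X' *m (Y' *m Phi B *m X') = Y' *m A *m (X' *m Y' *m Phi B) *m X'.
    by rewrite !mulmxA.
  by rewrite -cXY' -!mulmxA YX' mulmx1.
split; split=> //.
- by move=> A B AB; rewrite !Phi0E Phi0M Phi_zp // mulmx0 mul0mx.
- move=> A; exists N.+1.
  have Phi0X j : (Y' *m Phi A *m X') ^+ j.+1 = Y' *m (Phi A ^+ j.+1) *m X'.
    by elim: j => [|j IH]; rewrite ?expr1 // exprSr IH -mulmxE Phi0M [in RHS]exprSr.
  have PhiX : Phi A ^+ N.+1 = T ^+ N * Phi (A ^+ N.+1) by apply: zero_prod_exp.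
  rewrite Phi0E Phi0X PhiX -[Y']Y'E XY' -!mulmxA.
  have [_ _ TN] := dG.
  have -> : (1%:M - T *m G) *m (T ^+ N *m (Phi (A ^+ N.+1) *m X')) = 0.
    have cN : GRing.comm (T ^+ N) (1 - T * G).
      apply/commr_sym/commrX/commr_sym/commrB; first exact: commr1.
      by apply: commrM => //; case: dG.
    have cN0 : (1%:M - T *m G) *m T ^+ N = 0 by rewrite -[LHS]cN mulrBr mulr1 TN subrr.
    rewrite [LHS]mulmxA; apply: etrans (congr1 (mulmx^~ _) cN0) _.
    exact: mul0mx.
  by rewrite mulmx0.
- by move=> A; rewrite (fS A) Phi0E.
Qed.

Variable (i0 : 'I_n).
Let E i j := G *m Phi (delta_mx i j).

(** Phi A Phi B = T Phi(A B) and G T G = G make A -> G Phi(A) multiplicative. *)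
Lemma drazin_unitsM i j k l : E i j *m E k l = E i l *+ (j == k).
Proof.
have [cTG GTG _] := dG.
have -> : E i j *m E k l = G * (G * (Phi (delta_mx i j) * Phi (delta_mx k l))).
  by rewrite /E !mulmxE -mulrA [Phi _ * (G * _)]mulrA PhiG !mulrA.
rewrite PhiM (_ : delta_mx i j * _ = delta_mx i l *+ (j == k)); last exact: mul_delta_mx_cond.
by rewrite linearMn /= !mulrnAr [G * (T * _)]mulrA -cTG !mulrA GTG.
Qed.

Lemma sum_drazin_units : \sum_p E p p = T *m G.
Proof.
have [cTG _ _] := dG; rewrite -mulmx_sumr -linear_sum /= -mx1_sum_delta.
by rewrite [RHS]cTG.
Qed.

Variables (k : nat) (U : 'M[F]_(r, k)) (V : 'M[F]_(k, r)).
Hypotheses (UV : U *m V = E i0 i0) (VU : V *m U = 1%:M).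

(** Two uses of the product rule give E i0 q Phi(A) E p i0 = A q p T E i0 i0, so the entry of A
    factors out and the compression of T remains. *)
Lemma drazin_corner A :
  units_row E i0 V *m Phi A *m units_col E i0 U = kron (V *m T *m U) A.
Proof.
have [cTG GTG _] := dG.
apply/matrixP => a b; rewrite -(mxtens_unindexK a) -(mxtens_unindexK b).
case: (mxtens_unindex a) => j q; case: (mxtens_unindex b) => i p.
rewrite units_row_col kronE tensmxE.
have -> : E i0 q *m Phi A *m E p i0 = A q p *: (T *m E i0 i0).
  have -> : A q p *: (T *m E i0 i0) = T * (G * Phi (delta_mx i0 q * A * delta_mx p i0)).
    have -> : delta_mx i0 q * A * delta_mx p i0 = A q p *: delta_mx i0 i0.
      exact: delta_mul_delta.
    by rewrite linearZ /= -!mulmxE -!scalemxAr.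
  have -> : E i0 q *m Phi A *m E p i0 =
      G * (G * (Phi (delta_mx i0 q) * Phi A * Phi (delta_mx p i0))).
    rewrite /E !mulmxE -!mulrA; congr (_ * _).
    by rewrite [Phi A * _]mulrA PhiG -mulrA [LHS]mulrA PhiG -mulrA.
  rewrite PhiM -mulrA PhiM !mulrA; congr (_ * _).
  by rewrite -[G * G * T]mulrA -cTG mulrA GTG -cTG.
rewrite -scalemxAr -scalemxAl mxE mulrC -UV; congr (_ * _).
by rewrite !mulmxA -[_ *m U]mulmxA VU mulmx1.
Qed.

(** The inverse is V G U, because T E i0 i0 G = E i0 i0. *)
Lemma drazin_corner_unit : V *m T *m U \in unitmx.
Proof.
have [cTG GTG _] := dG.
have TEG : T *m E i0 i0 *m G = E i0 i0.
  by rewrite /E !mulmxE -mulrA -[G * _ * G]mulrA PhiG !mulrA cTG GTG.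
suff : (V *m T *m U) *m (V *m G *m U) = 1%:M by case/mulmx1_unit.
have -> : (V *m T *m U) *m (V *m G *m U) = V *m (T *m (U *m V) *m G) *m U.
  by rewrite !mulmxA.
by rewrite UV TEG -UV mulmxA VU mul1mx.
Qed.

End BlockDecomposition.

(** * Splitting idempotents, and the block form over any field *)

Lemma idempotent_factor (F : fieldType) r (P : 'M[F]_r) : idempotent_mx P ->
  exists k (U : 'M_(r, k)) (V : 'M_(k, r)), U *m V = P /\ V *m U = 1%:M.
Proof.
move=> PP; have := mulmx_base P; have := row_base_free P; have := col_base_full P.
move: (row_base P) (col_base P) => V U fU fV UV; exists (\rank P), U, V; split=> //.
apply: (row_free_inj fV); apply: (row_full_inj fU).
by rewrite /= mul1mx !mulmxA UV -mulmxA UV PP.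
Qed.

Lemma drazin_idem (F : fieldType) r (T : 'M[F]_r) N G :
  drazin_inverse T N G -> idempotent_mx (1%:M - T *m G).
Proof.
case=> _ GTG _; rewrite /idempotent_mx mulmxBl mul1mx mulmxBr mulmx1.
rewrite -mulmxA (_ : G *m (T *m G) = G) ?subrr ?subr0 //.
by rewrite mulmxA [LHS]GTG.
Qed.

Lemma drazin0 (F : fieldType) r N (G : 'M[F]_r) : drazin_inverse 0 N G -> G = 0.
Proof. by case=> _ <- _; rewrite mulr0 mul0r. Qed.

Lemma zero_prod_block_form (F : fieldType) n r (Phi : {linear 'M[F]_n -> 'M[F]_r}) :
  zero_prod_pres Phi ->
  exists k m (e : (k * n + m)%N = r) (S : 'M[F]_r) (R1 : 'M[F]_k)
         (Phi0 : {linear 'M[F]_n -> 'M[F]_m}),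
    [/\ S \in unitmx, R1 \in unitmx, zero_prod_pres Phi0,
        (forall A, mx_nilpotent (Phi0 A)) & block_form Phi e S R1 Phi0].
Proof.
case: n Phi => [|n] Phi zp; have [N [G [dG cG]]] := drazin_inverse_exists (Phi 1%:M).
  (* For n = 0 there is no index [i0]; here T = G = 0 and the whole space goes to the nilpotent
     block. *)
  have T0 : Phi 1%:M = 0 by rewrite [1%:M]flatmx0 linear0.
  rewrite T0 in dG; have G0 := drazin0 dG; rewrite -T0 in dG.
  have [||||A|e [S [Phi0 [[? ? ? ?] _]]]] := @block_decomposition _ _ _ _ zp N G dG cG 0 r
    (0 : 'M_(r, 0 * 0)) (0 : 'M_(0 * 0, r)) 1%:M 1%:M 1%:M.
  - by apply/matrixP => -[x x0]; exfalso; move: x0; rewrite muln0.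
  - by rewrite T0 mul0mx mul0mx.
  - exact: mul1mx.
  - by rewrite T0 mul0mx subr0 mul1mx.
  - by apply/matrixP => -[x x0]; exfalso; move: x0; rewrite muln0.
  by exists 0, r, e, S, 1%:M, Phi0; split=> //; apply: unitmx1.
have Emul := drazin_unitsM zp dG cG.
have [|k [U [V [UV VU]]]] := @idempotent_factor _ _ (G *m Phi (delta_mx 0 0)).
  by rewrite /idempotent_mx Emul eqxx.
have [m [X' [Y' [XY' YX']]]] := idempotent_factor (drazin_idem dG).
have XY := etrans (units_col_row Emul UV) (sum_drazin_units dG).
have [e [S [Phi0 [[? ? ? ?] _]]]] :=
  block_decomposition zp dG cG (units_row_col1 Emul UV VU) XY YX' XY'
    (drazin_corner zp dG cG UV VU).
exists k, m, e, S, (V *m Phi 1%:M *m U), Phi0; split=> //.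
exact (drazin_corner_unit zp dG cG UV VU).
Qed.

(** * Rank one idempotents and vanishing criteria *)

Lemma rank1_idem_outer (F : fieldType) n (u : 'cV[F]_n) (v : 'rV_n) :
  v *m u = 1%:M -> rank1_idem (u *m v).
Proof.
move=> vu; split; last by rewrite /idempotent_mx -mulmxA [v *m _]mulmxA vu mul1mx.
apply/eqP; rewrite eqn_leq (leq_trans (mulmx_max_rank _ _)) // lt0n mxrank_eq0.
apply/eqP => uv0.
have : v *m (u *m v) *m u = 1%:M by rewrite mulmxA vu mul1mx vu.
by rewrite uv0 mulmx0 mul0mx => /matrixP/(_ 0 0)/eqP; rewrite !mxE eqxx mulr1n eq_sym oner_eq0.
Qed.

Lemma rank1_idem_delta (F : fieldType) n (i : 'I_n) : rank1_idem (delta_mx i i : 'M[F]_n).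
Proof.
rewrite -(mul_delta_mx (0 : 'I_1)); apply: rank1_idem_outer.
by rewrite mul_delta_mx; apply/matrixP => a b; rewrite !ord1 !mxE.
Qed.

Lemma rank1_idem_deltaD (F : fieldType) n (i j : 'I_n) : i != j ->
  rank1_idem (delta_mx i i + delta_mx i j : 'M[F]_n).
Proof.
move=> ij; rewrite -(mul_delta_mx (0 : 'I_1) i i) -(mul_delta_mx (0 : 'I_1) i j) -mulmxDr; apply: rank1_idem_outer.
rewrite mulmxDl mul_delta_mx mul_delta_mx_0 1?eq_sym // addr0.
by apply/matrixP => a b; rewrite !ord1 !mxE.
Qed.

(** This is u v for u = (e_i + b e_j) / 2 and v the row e_i + a e_j. It is symmetric for a = b = 1
    and Hermitian when b is the conjugate of a. *)
Lemma rank1_idem_pair (F : fieldType) n (a b : F) (i j : 'I_n) :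
  2%:R != 0 :> F -> a * b = 1 -> i != j ->
  rank1_idem (2%:R^-1 *: (delta_mx i i + delta_mx j j + a *: delta_mx i j + b *: delta_mx j i)
              : 'M[F]_n).
Proof.
move=> n2 ab ij.
pose v : 'rV[F]_n := delta_mx 0 i + a *: delta_mx 0 j.
pose u : 'cV[F]_n := 2%:R^-1 *: (delta_mx i 0 + b *: delta_mx j 0).
rewrite [X in rank1_idem X](_ : _ = u *m v); last first.
  rewrite /u /v -scalemxAl mulmxDl !mulmxDr -!scalemxAl -!scalemxAr !mul_delta_mx.
  rewrite scalerA [b * a]mulrC ab scale1r; congr (_ *: _); rewrite -!addrA; congr (_ + _).
  by rewrite addrC -addrA.
apply: rank1_idem_outer; rewrite /u /v -scalemxAr mulmxDl !mulmxDr -!scalemxAl -!scalemxAr.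
rewrite !mul_delta_mx !mul_delta_mx_0 // 1?eq_sym // !scaler0 scalerA ab scale1r.
by rewrite addr0 add0r; apply/matrixP => x y; rewrite !ord1 !mxE /= -natrD mulVf.
Qed.

Lemma linear_delta0 (F : fieldType) n r (f : {linear 'M[F]_n -> 'M[F]_r}) :
  (forall i j, f (delta_mx i j) = 0) -> forall A, f A = 0.
Proof.
move=> f0 A; rewrite [A]matrix_sum_delta linear_sum big1 // => i _.
by rewrite linear_sum big1 // => j _; rewrite linearZ /= f0 scaler0.
Qed.

Lemma idempotent_nilpotent (F : fieldType) m (M : 'M[F]_m) :
  idempotent_mx M -> mx_nilpotent M -> M = 0.
Proof.
move=> MM [p Mp].
have ME q : M ^+ q.+1 = M.
  by elim: q => [|q IH]; rewrite ?expr1 // exprS IH [LHS]MM.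
by rewrite -(ME p) exprS Mp mulr0.
Qed.

Lemma block_form_corner (F : fieldType) n r (Phi : 'M[F]_n -> 'M[F]_r) k m
    (e : (k * n + m)%N = r) S R1 (Phi0 : 'M[F]_n -> 'M[F]_m) A :
  S \in unitmx -> block_form Phi e S R1 Phi0 ->
  idempotent_mx (Phi A) -> idempotent_mx (Phi0 A).
Proof.
move=> uS fS; rewrite /idempotent_mx fS.
case: r / e S uS {fS Phi} => S uS; rewrite castmx_id => SS.
have : block_mx (kron R1 A) 0 0 (Phi0 A) *m block_mx (kron R1 A) 0 0 (Phi0 A)
     = block_mx (kron R1 A) 0 0 (Phi0 A).
  move/(congr1 (fun M => invmx S *m M *m S)): SS.
  by rewrite -!mulmxA mulVmx // mulmx1 !mulmxA mulVmx // mul1mx mulmxKV.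
by rewrite mulmx_block !mulmx0 !mul0mx !addr0 add0r => /eq_block_mx[].
Qed.

(** * Matrix involutions and orthogonal splittings *)

Section Star.
Variables (F : fieldType) (sigma : {rmorphism F -> F}).
Hypothesis sigmaK : involutive sigma.

(** A general [sigma] treats the transpose (identity) and the conjugate transpose together. *)
Definition starmx p q (A : 'M[F]_(p, q)) : 'M_(q, p) := map_mx sigma A^T.
Local Notation "A ^*" := (starmx A) : ring_scope.

Lemma starmxM p q s (A : 'M_(p, q)) (B : 'M_(q, s)) : (A *m B)^* = B^* *m A^*.
Proof. by rewrite /starmx trmx_mul map_mxM. Qed.

Lemma starmxK p q (A : 'M_(p, q)) : A^*^* = A.
Proof. by apply/matrixP => i j; rewrite !mxE sigmaK. Qed.

Lemma starmxD p q (A B : 'M_(p, q)) : (A + B)^* = A^* + B^*.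
Proof. by rewrite /starmx linearD map_mxD. Qed.

Lemma starmxB p q (A B : 'M_(p, q)) : (A - B)^* = A^* - B^*.
Proof. by rewrite /starmx linearB map_mxB. Qed.

Lemma starmxZ p q a (A : 'M_(p, q)) : (a *: A)^* = sigma a *: A^*.
Proof. by rewrite /starmx linearZ map_mxZ. Qed.

Lemma starmx0 p q : (0 : 'M_(p, q))^* = 0.
Proof. by rewrite /starmx trmx0 map_mx0. Qed.

Lemma starmx1 p : (1%:M : 'M_p)^* = 1%:M.
Proof. by rewrite /starmx trmx1 map_mx1. Qed.

Lemma starmx_sum p q I (s : seq I) (P : pred I) (A : I -> 'M_(p, q)) :
  (\sum_(i <- s | P i) A i)^* = \sum_(i <- s | P i) (A i)^*.
Proof. exact: (big_morph _ (@starmxD p q) (@starmx0 p q)). Qed.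

Lemma starmx_exp p (A : 'M_p) j : (A ^+ j)^* = A^* ^+ j.
Proof.
elim: j => [|j IH]; first by rewrite !expr0 starmx1.
by rewrite exprS exprSr -IH; exact: starmxM.
Qed.

Lemma starmx_row p q s (A : 'M_(p, q)) (B : 'M_(p, s)) : (row_mx A B)^* = col_mx A^* B^*.
Proof. by rewrite /starmx tr_row_mx map_col_mx. Qed.

Lemma starmx_cast p q p' q' (ep : p = p') (eq : q = q') (A : 'M_(p, q)) :
  (castmx (ep, eq) A)^* = castmx (eq, ep) A^*.
Proof. by case: p' / ep; case: q' / eq; rewrite !castmx_id. Qed.

(** Isolates what the field must supply for orthogonal splittings. In (b) and (c) it comes from
    positivity and square roots, in (d) from square roots without positivity. *)
Definition unit_vector_property r := forall P : 'M[F]_r,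
  P != 0 -> P^* = P -> P *m P = P -> exists v : 'rV_r, v *m P = v /\ v *m v^* = 1%:M.

(* Splitting off unit vectors one at a time, each of which lowers the rank. *)
Lemma selfadjoint_idempotent_factor r (P : 'M[F]_r) : unit_vector_property r ->
  P^* = P -> P *m P = P ->
  exists k (V : 'M_(k, r)), V *m V^* = 1%:M /\ V^* *m V = P.
Proof.
move=> unitv; have [d] := ubnP (\rank P); elim: d => // d IH in P * => rP sP PP.
have [P0|nP0] := eqVneq P 0.
  exists 0%N, 0; split; first by rewrite [LHS]flatmx0 [RHS]flatmx0.
  by rewrite mulmx0 P0.
have [v [vP vv]] := unitv P nP0 sP PP.
have Pv : P *m v^* = v^* by rewrite -{1}sP -starmxM vP.
pose Q := P - v^* *m v.
have vQ : v *m Q = 0 by rewrite mulmxBr vP mulmxA vv mul1mx subrr.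
have Qv : Q *m v^* = 0 by rewrite mulmxBl Pv -mulmxA vv mulmx1 subrr.
have sQ : Q^* = Q by rewrite starmxB sP starmxM starmxK.
have QP : Q *m P = Q by rewrite mulmxBl PP -mulmxA vP.
have QQ : Q *m Q = Q by rewrite {2}/Q mulmxBr QP mulmxA Qv mul0mx subr0.
(* The inclusion is strict: v lies in the row space of P, but in that of Q it would satisfy v = v Q
   = 0. *)
have ltQP : (Q < P)%MS.
  rewrite /ltmx -{1}QP submxMl /=; apply/negP => PQ.
  have vsQ : (v <= Q)%MS by rewrite -vP (submx_trans (submxMl _ _)).
  have v0 : v = 0 by case/submxP: vsQ => B vE; rewrite -vQ vE -mulmxA QQ.
  by move: vv; rewrite v0 mul0mx => /matrixP/(_ 0 0)/eqP; rewrite !mxE eq_sym oner_eq0.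
have [k [V [VV VQ]]] := IH Q (leq_trans (rank_ltmx ltQP) rP) sQ QQ.
have Vv : V *m v^* = 0 by rewrite -[V]mul1mx -VV -!mulmxA [V^* *m _]mulmxA VQ Qv mulmx0.
have vV : v *m V^* = 0 by rewrite -[v *m _]starmxK starmxM starmxK Vv starmx0.
exists (1 + k)%N, (col_mx v V).
have -> : (col_mx v V)^* = row_mx v^* V^* by rewrite -[RHS]starmxK starmx_row !starmxK.
split; first by rewrite mul_col_row vv VV Vv vV -scalar_mx_block.
by rewrite mul_row_col VQ addrC subrK.
Qed.

(** The star of G is again a Drazin inverse of T. It commutes with T, hence with G, so uniqueness
    applies. *)
Lemma starmx_drazin r (T : 'M[F]_r) N G : drazin_inverse T N G ->
  (forall B, GRing.comm B T -> GRing.comm B G) -> T^* = T -> G^* = G.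
Proof.
move=> dG cG sT; have [cTG GTG TN] := dG.
have sM (A B : 'M[F]_r) : (A * B)^* = B^* * A^* by apply: starmxM.
have cT : GRing.comm T G^* by rewrite /GRing.comm -{1}sT -sM -cTG sM sT.
apply/esym; apply: (drazin_inverse_unique dG); last exact/commr_sym/cG/commr_sym.
split=> //; first by rewrite -mulrA -{1}sT -!sM GTG.
have := congr1 (@starmx r r) TN; rewrite !sM starmx_exp sT -cT => {2}<-.
by apply/commr_sym/commrX/commr_sym/commrM.
Qed.

Section StarBlockForm.
Variables (n r : nat) (Phi : {linear 'M[F]_n -> 'M[F]_r}).
Hypotheses (zp : zero_prod_pres Phi) (unitv : unit_vector_property r).
Hypothesis Phi_diag : forall i, (Phi (delta_mx i i))^* = Phi (delta_mx i i).
Hypothesis Phi_offdiag : forall i j, i != j ->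
  (Phi (delta_mx i j + delta_mx j i))^* = Phi (delta_mx i j + delta_mx j i).

Lemma starmx_drazin_units N G : drazin_inverse (Phi 1%:M) N G ->
  (forall B, GRing.comm B (Phi 1%:M) -> GRing.comm B G) -> G^* = G ->
  forall i j, (G *m Phi (delta_mx i j))^* = G *m Phi (delta_mx j i).
Proof.
move=> dG cG sG i j.
have Emul := drazin_unitsM zp dG cG.
have sE A : (Phi A)^* = Phi A -> (G *m Phi A)^* = G *m Phi A.
  by move=> sA; rewrite starmxM sA sG; apply/cG; apply: zero_prod_comm.
have [<-|ij] := eqVneq i j; first exact/sE.
have Eij : G *m Phi (delta_mx i i) *m (G *m Phi (delta_mx i j + delta_mx j i)) =
    G *m Phi (delta_mx i j).
  by rewrite linearD mulmxDr mulmxDr !Emul eqxx (negPf ij) addr0.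
have Eji : (G *m Phi (delta_mx i j + delta_mx j i)) *m (G *m Phi (delta_mx i i)) =
    G *m Phi (delta_mx j i).
  by rewrite linearD mulmxDr mulmxDl !Emul eqxx [j == i]eq_sym (negPf ij) add0r.
by rewrite -Eij starmxM !sE ?Eji //; apply: Phi_offdiag.
Qed.

(** Common source of (b), (c) and (d). The last clause feeds the argument that selfadjoint nilpotent
    blocks vanish. *)
Lemma star_block_form :
  exists k m (e : (k * n + m)%N = r) (S : 'M[F]_r) (R1 : 'M[F]_k)
         (Phi0 : {linear 'M[F]_n -> 'M[F]_m}),
    [/\ S \in unitmx, R1 \in unitmx, zero_prod_pres Phi0,
        (forall A, mx_nilpotent (Phi0 A)) & block_form Phi e S R1 Phi0] /\
    [/\ R1^* = R1, invmx S = S^*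
      & forall A, (Phi A)^* = Phi A -> (Phi0 A)^* = Phi0 A].
Proof.
have sT : (Phi 1%:M)^* = Phi 1%:M.
  rewrite mx1_sum_delta linear_sum starmx_sum; apply: eq_bigr => i _; exact: Phi_diag.
have [N [G [dG cG]]] := drazin_inverse_exists (Phi 1%:M).
have sG := starmx_drazin dG cG sT.
have sE := starmx_drazin_units dG cG sG.
have [k [X [R1 [uR sR [XX XY PhiR]]]]] : exists k (X : 'M_(r, k * n)) (R1 : 'M_k),
  [/\ R1 \in unitmx, R1^* = R1 & [/\ X^* *m X = 1%:M, X *m X^* = Phi 1%:M *m G &
    forall A, X^* *m Phi A *m X = kron R1 A]].
  case: (posnP n) => [n0|n_gt0].
    exists 0%N, 0, 1%:M; split; [exact: unitmx1|exact: starmx1|].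
    have T0 : Phi 1%:M = 0.
      by rewrite (_ : 1%:M = 0) ?linear0 //; apply/matrixP => -[x x0]; exfalso; rewrite n0 in x0.
    by split=> *; try (by apply/matrixP => -[x x0]; exfalso; move: x0; rewrite n0 muln0);
       rewrite mul0mx T0 mul0mx.
  pose i0 := Ordinal n_gt0.
  have Emul := drazin_unitsM zp dG cG.
  have [||k [V [VV VE]]] :=
      @selfadjoint_idempotent_factor r (G *m Phi (delta_mx i0 i0)) unitv.
  - exact: sE.
  - by rewrite Emul eqxx.
  (* As the star swaps the units (i, j) and (j, i), one factor V yields both halves of the
     splitting, with Y the star of X. *)
  have sX : (units_col (fun i j => G *m Phi (delta_mx i j)) i0 V^*)^* =
            units_row (fun i j => G *m Phi (delta_mx i j)) i0 V.
    apply/matrixP => a x; rewrite [LHS]mxE 2![X in sigma X]mxE [RHS]mxE.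
    rewrite -(sE (mxtens_unindex a).2 i0) -{2}(starmxK V) -starmxM.
    by rewrite [RHS]mxE [X in _ = sigma X]mxE.
  exists k, (units_col (fun i j => G *m Phi (delta_mx i j)) i0 V^*), (V *m Phi 1%:M *m V^*).
  rewrite sX; split.
  - exact (drazin_corner_unit zp dG cG VE VV).
  - by rewrite !starmxM starmxK sT mulmxA.
  - split; first exact: (units_row_col1 Emul VE VV).
      exact: (etrans (units_col_row Emul VE) (sum_drazin_units dG)).
    exact: (drazin_corner zp dG cG VE VV).
have sQ : (1%:M - Phi 1%:M *m G)^* = 1%:M - Phi 1%:M *m G.
  by rewrite starmxB starmx1 starmxM sT sG; congr (_ - _); case: dG.
have [m [V [VV VQ]]] := selfadjoint_idempotent_factor unitv sQ (drazin_idem dG).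
have [e [S [Phi0 [[uS zp0 nil0 fS] [SE iSE Phi0E]]]]] :=
  block_decomposition zp dG cG XX XY VV VQ PhiR.
exists k, m, e, S, R1, Phi0; split; split=> //.
  by rewrite iSE SE starmx_cast starmx_row starmxK.
by move=> A sA; rewrite Phi0E !starmxM starmxK sA mulmxA.
Qed.

End StarBlockForm.

(** * Anisotropic forms and unit vectors *)

Definition anisotropic r := forall w : 'rV[F]_r, w != 0 ->
  exists2 c, c != 0 & w *m w^* = (c * sigma c)%:M.

(** Any nonzero row of P is fixed by P; dividing it by c normalizes it. *)
Lemma anisotropic_unit_vector r : anisotropic r -> unit_vector_property r.
Proof.
move=> an P P0 sP PP.
have [i Pi] : exists i, row i P != 0.
  by apply/existsP; rewrite -negb_forall; apply: contra P0 => /forallP P0;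
    apply/eqP/row_matrixP => i; rewrite row0; apply/eqP.
have [c c0 cc] := an _ Pi; exists (c^-1 *: row i P); split.
  by rewrite -scalemxAl -row_mul PP.
rewrite starmxZ -scalemxAl -scalemxAr cc scalerA scale_scalar_mx fmorphV.
by rewrite -invfM mulVf // mulf_neq0 // fmorph_eq0.
Qed.

(** If B is selfadjoint with B B = 0, its rows have norm zero, so B = 0. Starting from the power 2^p
    of M, this halves the exponent down to 1. *)
Lemma anisotropic_selfadjoint_nilpotent m (M : 'M[F]_m) : anisotropic m ->
  M^* = M -> mx_nilpotent M -> M = 0.
Proof.
move=> an sM [p Mp].
have sq0 (B : 'M[F]_m) : B^* = B -> B *m B = 0 -> B = 0.
  move=> sB BB; apply/row_matrixP => i; rewrite row0.
  apply/eqP; case: (eqVneq (row i B) 0) => // /an[c c0].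
  rewrite (_ : row i B *m _ = 0); last first.
    by rewrite rowE starmxM sB -mulmxA [B *m (B *m _)]mulmxA BB mul0mx mulmx0.
  by move=> /matrixP/(_ 0 0)/eqP; rewrite !mxE eqxx eq_sym mulf_eq0 fmorph_eq0 (negPf c0).
have {Mp} : M ^+ (2 ^ p) = 0.
  by rewrite -(subnK (ltnW (ltn_expl p (isT : 1 < 2)%N))) exprD Mp mulr0.
elim: p => [|p IH]; first by rewrite expn0 expr1.
rewrite expnS mul2n -addnn exprD => /sq0 Mp; apply: IH; apply: Mp.
by rewrite starmx_exp sM.
Qed.

End Star.

Lemma anisotropicP (F : numFieldType) (sigma : {rmorphism F -> F}) r :
  (forall x, x != 0 -> 0 < x * sigma x) ->
  (forall s, 0 < s -> exists2 c, c != 0 & c * sigma c = s) -> anisotropic sigma r.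
Proof.
move=> pos sqrt w w0.
have pos0 x : 0 <= x * sigma x by case: (eqVneq x 0) => [->|/pos/ltW//]; rewrite mul0r.
have [|c c0 cE] := sqrt (\sum_j w 0 j * sigma (w 0 j)).
  rewrite lt_def sumr_ge0 // andbT psumr_neq0 //.
  have /existsP[j wj] : [exists j, w 0 j != 0].
    rewrite -negb_forall; apply: contra w0 => /forallP w0; apply/eqP/rowP => j.
    by rewrite mxE; apply/eqP.
  by apply/hasP; exists j; rewrite ?mem_index_enum ?pos.
exists c => //; apply/matrixP => a b; rewrite !ord1 cE !mxE mulr1n.
by apply: eq_bigr => j _; rewrite !mxE.
Qed.

Lemma rcf_anisotropic (R : rcfType) r : anisotropic (idfun : {rmorphism R -> R}) r.
Proof.
apply: anisotropicP => [x x0|s s0] /=.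
  by rewrite -expr2 lt_def sqrf_eq0 x0 sqr_ge0.
by exists (Num.sqrt s); [rewrite gt_eqF ?sqrtr_gt0|rewrite -expr2 sqr_sqrtr ?ltW].
Qed.

Lemma conj_anisotropic (C : numClosedFieldType) r : anisotropic (@Num.conj C) r.
Proof.
apply: anisotropicP => [x x0|s s0]; first by rewrite mul_conjC_gt0.
exists (sqrtC s); first by rewrite sqrtC_eq0 gt_eqF.
by rewrite /= geC0_conj ?sqrtC_ge0 ?ltW // -expr2 sqrtCK.
Qed.

Lemma starmx_idfun (F : fieldType) p q (A : 'M[F]_(p, q)) : starmx idfun A = A^T.
Proof. exact: map_mx_id. Qed.

(* If the diagonal of [P] vanishes, the rows [i] and [j] are isotropic, but their
   sum has square [2 * P i j]. *)
Lemma closed_unit_vector (C : numClosedFieldType) r :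
  unit_vector_property (idfun : {rmorphism C -> C}) r.
Proof.
move=> P P0; rewrite starmx_idfun => sP PP.
(* Any nonzero square will do, since its square root rescales w to a unit vector. *)
suff [w wP [c c0 wc]] : exists2 w : 'rV_r, w *m P = w & exists2 c, c != 0 & w *m w^T = c%:M.
  have s0 : sqrtC c != 0 by rewrite sqrtC_eq0.
  exists ((sqrtC c)^-1 *: w); rewrite -scalemxAl wP starmx_idfun; split=> //.
  rewrite linearZ /= -scalemxAl -scalemxAr wc scalerA scale_scalar_mx -invfM -expr2 sqrtCK.
  by rewrite mulVf.
(* The Gram matrix of the rows of P is P itself. *)
have Pij i j : row i P *m (row j P)^T = (P i j)%:M.
  rewrite !rowE trmx_mul sP -mulmxA [P *m (P *m _)]mulmxA PP trmx_delta -colE -rowE.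
  by rewrite [LHS]mx11_scalar !mxE.
have rP i : row i P *m P = row i P by rewrite -row_mul PP.
have [/existsP[i Pi]|] := boolP [exists i, P i i != 0].
  by exists (row i P) => //; exists (P i i).
rewrite negb_exists => /forallP Pii.
have /existsP[i /existsP[j Pj]] : [exists i, exists j, P i j != 0].
  apply: contraT; rewrite negb_exists => /forallP H; case/eqP: P0; apply/matrixP => i j.
  by have := H i; rewrite negb_exists => /forallP/(_ j); rewrite negbK mxE => /eqP.
exists (row i P + row j P); first by rewrite mulmxDl !rP.
exists (P i j *+ 2); first by rewrite mulrn_eq0.
rewrite linearD mulmxDl !mulmxDr !Pij.
have Pd l : P l l = 0 by apply/eqP; have := Pii l; rewrite negbK.
have -> : P j i = P i j by rewrite -[in LHS]sP mxE.
by rewrite !Pd mulr2n !raddfD raddf0 /= add0r addr0.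
Qed.

(** * Off-diagonal units from rank one idempotents *)

Section Pairs.
Variables (F : fieldType) (sigma : {rmorphism F -> F}) (n r : nat).
Variable Phi : {linear 'M[F]_n -> 'M[F]_r}.
Hypothesis two_neq0 : 2%:R != 0 :> F.

Definition pair_proj (a b : F) (i j : 'I_n) : 'M[F]_n :=
  2%:R^-1 *: (delta_mx i i + delta_mx j j + a *: delta_mx i j + b *: delta_mx j i).

Lemma pair_projE a b i j :
  a *: delta_mx i j + b *: delta_mx j i =
  2%:R *: pair_proj a b i j - (delta_mx i i + delta_mx j j).
Proof.
rewrite /pair_proj scalerA divff // scale1r; apply/esym/eqP.
by rewrite subr_eq [eqbRHS]addrC addrA.
Qed.

(** E_ij + E_ji is twice a rank one idempotent minus E_ii + E_jj, so hypotheses on rank one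
    idempotents reach the off-diagonal units. *)
Lemma starmx_offdiag i j :
  starmx sigma (Phi (delta_mx i i)) = Phi (delta_mx i i) ->
  starmx sigma (Phi (delta_mx j j)) = Phi (delta_mx j j) ->
  starmx sigma (Phi (pair_proj 1 1 i j)) = Phi (pair_proj 1 1 i j) ->
  starmx sigma (Phi (delta_mx i j + delta_mx j i)) = Phi (delta_mx i j + delta_mx j i).
Proof.
move=> si sj sij; rewrite -[delta_mx i j]scale1r -[delta_mx j i]scale1r pair_projE.
by rewrite linearB linearD linearZ /= starmxB starmxD starmxZ si sj sij rmorph_nat.
Qed.

End Pairs.

Lemma tr_pair_proj (F : fieldType) n (i j : 'I_n) :
  (pair_proj 1 1 i j)^T = pair_proj 1 1 i j :> 'M[F]_n.
Proof.
by rewrite /pair_proj !scale1r linearZ !linearD /= !trmx_delta addrAC !scalerDr.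
Qed.

(** * Assembly of the block form and its four refinements *)

Theorem theorem3p5 :
  (* main statement, arbitrary field *)
  (forall (F : fieldType) (n r : nat) (Phi : {linear 'M[F]_n -> 'M[F]_r}),
    zero_prod_pres Phi ->
    exists (k m : nat) (e : (k * n + m)%N = r) (S : 'M[F]_r) (R1 : 'M[F]_k)
           (Phi0 : {linear 'M[F]_n -> 'M[F]_m}),
      [/\ S \in unitmx, R1 \in unitmx, zero_prod_pres Phi0,
          (forall A, mx_nilpotent (Phi0 A)) & block_form Phi e S R1 Phi0]) /\
  (* (a) *)
  (forall (F : fieldType) (n r : nat) (Phi : {linear 'M[F]_n -> 'M[F]_r}),
    zero_prod_pres Phi ->
    (forall A : 'M[F]_n, rank1_idem A -> idempotent_mx (Phi A)) ->
    exists (k m : nat) (e : (k * n + m)%N = r) (S : 'M[F]_r) (R1 : 'M[F]_k),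
      [/\ S \in unitmx, R1 \in unitmx & block_form Phi e S R1 (fun _ => 0)]) /\
  (* (b) complex case, Hermitian images of rank one orthogonal projections *)
  (forall (C : numClosedFieldType) (n r : nat) (Phi : {linear 'M[C]_n -> 'M[C]_r}),
    zero_prod_pres Phi ->
    (forall A : 'M[C]_n, rank1_idem A -> adjmx A = A -> adjmx (Phi A) = Phi A) ->
    exists (k m : nat) (e : (k * n + m)%N = r) (S : 'M[C]_r) (R1 : 'M[C]_k),
      [/\ S \in unitmx, R1 \in unitmx, adjmx R1 = R1, invmx S = adjmx S
        & block_form Phi e S R1 (fun _ => 0)]) /\
  (* (c) real case (stated over any real closed field) *)
  (forall (R : rcfType) (n r : nat) (Phi : {linear 'M[R]_n -> 'M[R]_r}),
    zero_prod_pres Phi ->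
    (forall A : 'M[R]_n, A^T = A -> rank1_idem A -> (Phi A)^T = Phi A) ->
    exists (k m : nat) (e : (k * n + m)%N = r) (S : 'M[R]_r) (R1 : 'M[R]_k)
           (Phi0 : {linear 'M[R]_n -> 'M[R]_m}),
      [/\ S \in unitmx, R1 \in unitmx, zero_prod_pres Phi0,
          (forall A, mx_nilpotent (Phi0 A)) & block_form Phi e S R1 Phi0] /\
      [/\ invmx S = S^T,
          (forall A : 'M[R]_n, A^T = A -> Phi0 A = 0)
        & (forall X Y : 'M[R]_n, Phi0 X *m Phi0 Y = 0)]) /\
  (* (d) complex case, transpose-symmetric images of real symmetric rank one idempotents *)
  (forall (C : numClosedFieldType) (n r : nat) (Phi : {linear 'M[C]_n -> 'M[C]_r}),
    zero_prod_pres Phi ->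
    diagonalizable (Phi 1%:M) ->
    (forall A : 'M[C]_n, A \is a mxOver Num.real -> A^T = A -> rank1_idem A ->
        (Phi A)^T = Phi A) ->
    exists (k m : nat) (e : (k * n + m)%N = r) (S : 'M[C]_r) (R1 : 'M[C]_k)
           (Phi0 : {linear 'M[C]_n -> 'M[C]_m}),
      [/\ S \in unitmx, R1 \in unitmx, zero_prod_pres Phi0,
          (forall A, mx_nilpotent (Phi0 A)) & block_form Phi e S R1 Phi0] /\
      (R1^T = R1 /\ invmx S = S^T)).

Proof.
have two (K : numFieldType) : 2%:R != 0 :> K by rewrite pnatr_eq0.
have idK (K : fieldType) : involutive (idfun : {rmorphism K -> K}) by [].
split; first exact: zero_prod_block_form.
split.
  move=> F n r Phi zp Pidem.
  have [k [m [e [S [R1 [Phi0 [uS uR zp0 nil0 fS]]]]]]] := zero_prod_block_form zp.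
  exists k, m, e, S, R1; split=> //.
  (* On rank one idempotents the block is both idempotent and nilpotent. These span, since E_ij =
     (E_ii + E_ij) - E_ii. *)
  have P0 A : rank1_idem A -> Phi0 A = 0.
    by move=> /Pidem PA; apply: idempotent_nilpotent (nil0 A); apply: block_form_corner fS PA.
  suff P00 A : Phi0 A = 0 by move=> A; rewrite fS P00.
  apply: linear_delta0 => i j; have [<-|ij] := eqVneq i j; first exact/P0/rank1_idem_delta.
  rewrite -[delta_mx i j](addKr (delta_mx i i)) linearD linearN /=.
  by rewrite !P0 ?subrr ?addNr //; [apply: rank1_idem_delta|apply: rank1_idem_deltaD].
split.
  move=> C n r Phi zp sPhi.
  have sd i : starmx Num.conj (Phi (delta_mx i i)) = Phi (delta_mx i i).
    apply: sPhi; first exact: rank1_idem_delta.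
    by rewrite /adjmx trmx_delta map_delta_mx.
  have sp a i j : i != j -> a * a^* = 1 ->
      starmx Num.conj (Phi (pair_proj a a^* i j)) = Phi (pair_proj a a^* i j).
    move=> ij aa; apply: sPhi; first exact: rank1_idem_pair (two _) aa ij.
    rewrite /adjmx !linearE /= !trmx_delta !map_mxZ !map_mxD !map_mxZ !map_delta_mx /=.
    by rewrite fmorphV rmorph_nat conjCK addrAC.
  have so i j : i != j -> starmx Num.conj (Phi (delta_mx i j + delta_mx j i))
      = Phi (delta_mx i j + delta_mx j i).
    move=> ij; apply: (starmx_offdiag (two _)) => //.
    by have := sp 1 i j ij; rewrite conjC1 mulr1; apply.
  have [k [m [e [S [R1 [Phi0 [[uS uR zp0 nil0 fS] [sR iS sPhi0]]]]]]]] :=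
    star_block_form (@conjCK C) zp (anisotropic_unit_vector (@conj_anisotropic C r)) sd so.
  exists k, m, e, S, R1; split=> //.
  have P0 A : starmx Num.conj (Phi A) = Phi A -> Phi0 A = 0.
    move=> /sPhi0 sA; apply: anisotropic_selfadjoint_nilpotent sA (nil0 A).
    exact: conj_anisotropic.
  have Pd i : Phi0 (delta_mx i i) = 0 by exact: P0.
  have Pp a i j : i != j -> a * a^* = 1 ->
      a *: Phi0 (delta_mx i j) + a^* *: Phi0 (delta_mx j i) = 0.
    move=> ij aa; rewrite -!linearZ -linearD /= (pair_projE (two _)) linearB linearD linearZ /=.
    by rewrite !Pd P0 ?sp // scaler0 addr0 subr0.
  suff P00 A : Phi0 A = 0 by move=> A; rewrite fS P00.
  apply: linear_delta0 => i j; have [<-|ij] := eqVneq i j; first exact: Pd.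
  (* The phase 1 makes the sum of Phi0(E_ij) and Phi0(E_ji) vanish; the phase 'i, after scaling by
     -'i, makes their difference vanish. *)
  have := Pp 1 i j ij; rewrite conjC1 mulr1 !scale1r => /(_ erefl) E1.
  have := Pp 'i i j ij; rewrite -normCK normCi expr1n => /(_ erefl) /(congr1 ( *:%R (- 'i))).
  rewrite conjCi scalerDr !scalerA mulrNN mulNr -expr2 sqrCi opprK scaler0 scale1r scaleN1r => E2.
  have : Phi0 (delta_mx i j) *+ 2 = 0.
    rewrite mulr2n -{1}[Phi0 (delta_mx i j)](addrK (Phi0 (delta_mx j i))) E1 sub0r.
    by rewrite addrC E2.
  by move/eqP; rewrite -scaler_nat scaler_eq0 (negPf (two _)) => /eqP.
split.
  move=> R n r Phi zp sPhi.
  have sd i : starmx idfun (Phi (delta_mx i i)) = Phi (delta_mx i i).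
    by rewrite starmx_idfun; apply: sPhi; [apply: trmx_delta|apply: rank1_idem_delta].
  have so i j : i != j -> starmx idfun (Phi (delta_mx i j + delta_mx j i))
      = Phi (delta_mx i j + delta_mx j i).
    move=> ij; apply: (starmx_offdiag (two _)) => //; rewrite starmx_idfun; apply: sPhi.
      exact: tr_pair_proj.
    exact: rank1_idem_pair (two _) (mulr1 1) ij.
  have [k [m [e [S [R1 [Phi0 [[uS uR zp0 nil0 fS] [sR iS sPhi0]]]]]]]] :=
    star_block_form (idK _) zp (anisotropic_unit_vector (@rcf_anisotropic R r)) sd so.
  have P0 A : starmx idfun (Phi A) = Phi A -> Phi0 A = 0.
    move=> /sPhi0 sA; apply: anisotropic_selfadjoint_nilpotent sA (nil0 A).
    exact: rcf_anisotropic.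
  have Psym A : A^T = A -> Phi0 A = 0.
    (* Twice Phi0(A) is Phi0(A + A^T), a combination of the values at E_ij + E_ji. *)
    move=> sA; apply/eqP; rewrite -[_ == _]orFb -(negPf (two R)) -scaler_eq0 scaler_nat mulr2n.
    rewrite -{2}sA -linearD /= {1 2}[A]matrix_sum_delta.
    rewrite linear_sum -big_split linear_sum big1 // => i _ /=.
    rewrite linear_sum -big_split linear_sum big1 // => j _ /=.
    rewrite linearZ /= trmx_delta -scalerDr linearZ /=.
    have [<-|ij] := eqVneq i j; first by rewrite linearD /= P0 ?addr0 ?scaler0.
    by rewrite P0 ?scaler0 ?so.
  exists k, m, e, S, R1, Phi0; split; split=> //; first by rewrite iS starmx_idfun.
  (* Phi0(X) Phi0(Y) = Phi0(1) Phi0(X Y), and 1 is symmetric. *)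
  by move=> X Y; rewrite mulmxE zero_prod_mul // Psym ?mul0r // trmx1.
move=> C n r Phi zp _ sPhi.
have mxrealD (A B : 'M[C]_n) : A \is a mxOver Num.real -> B \is a mxOver Num.real ->
    A + B \is a mxOver Num.real.
  by move=> /mxOverP rA /mxOverP rB; apply/mxOverP => a b; rewrite mxE realD.
have rd i j : delta_mx i j \is a @mxOver n n C Num.real.
  by apply/mxOverP => a b; rewrite mxE realn.
have sd i : starmx idfun (Phi (delta_mx i i)) = Phi (delta_mx i i).
  by rewrite starmx_idfun; apply: sPhi; [apply: rd|apply: trmx_delta|apply: rank1_idem_delta].
have so i j : i != j -> starmx idfun (Phi (delta_mx i j + delta_mx j i))
    = Phi (delta_mx i j + delta_mx j i).
  move=> ij; apply: (starmx_offdiag (two _)) => //; rewrite starmx_idfun; apply: sPhi.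
  - by rewrite /pair_proj mxOverZ ?realV ?realn // !scale1r !mxrealD.
  - exact: tr_pair_proj.
  - exact: rank1_idem_pair (two _) (mulr1 1) ij.
(* The transpose form over C has isotropic vectors, so unit vectors come from
   [closed_unit_vector]. *)
have [k [m [e [S [R1 [Phi0 [[uS uR zp0 nil0 fS] [sR iS _]]]]]]]] :=
  star_block_form (idK _) zp (@closed_unit_vector C r) sd so.
exists k, m, e, S, R1, Phi0; split; split=> //; first by rewrite -[RHS]sR starmx_idfun.
by rewrite iS starmx_idfun.
Qed.
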